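(* Let $d\ge 2$ and $N$ be positive integers, let $A_1,\dots,A_N$ be unitary operators on $\mathbb{C}^d$ with $A_i^d=\mathbb{1}_d$ for all $i$, and assume that $\{A_1,\dots,A_N\}$ is genuinely incompatible. Let $\mathcal{H}_B$ be a finite-dimensional complex Hilbert space, let $\rho_{AB}$ be a density operator on $\mathbb{C}^d\otimes\mathcal{H}_B$ whose reduced state $\rho_B=\mathrm{Tr}_A(\rho_{AB})$ has full rank on $\mathcal{H}_B$, and for each $i=1,\dots,N$ let $\{N_{b|i}\}_{b=0}^{d-1}$ be a (not necessarily projective) $d$-outcome quantum measurement on $\mathcal{H}_B$, represented by $B_{k|i}=\sum_{b=0}^{d-1}\omega^{bk}N_{b|i}$, $k=0,\dots,d-1$, $\omega=e^{2\pi \mathrm{i}/d}$. Suppose that the steering inequality with functional $$\mathcal{B}_{d,N}=\sum_{i=1}^{N}\sum_{k=1}^{d-1}\mathrm{Tr}\big[(A_i^k\otimes B_{k|i})\rho_{AB}\big]$$ is maximally violated, i.e. $\mathcal{B}_{d,N}=N(d-1)$. Then: (i) all of Bob's measurements $\{N_{b|i}\}_b$ are projective, so that $B_{k|i}=B_i^k$ for all $k$, where $B_i:=B_{1|i}$ is unitary with $B_i^d=\mathbb{1}$; (ii) Bob's Hilbert space decomposes as $\mathcal{H}_B=(\mathbb{C}^d)_{B'}\otimes\mathcal{H}_{B''}$ for some Hilbert space $\mathcal{H}_{B''}$; (iii) there exist a unitary $U_B:\mathcal{H}_B\to\mathcal{H}_B=(\mathbb{C}^d)_{B'}\otimes\mathcal{H}_{B''}$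 and a density operator $\rho_{B''}$ on $\mathcal{H}_{B''}$ such that $$(\mathbb{1}_A\otimes U_B)\,\rho_{AB}\,(\mathbb{1}_A\otimes U_B^{\dagger})=|\phi_d^+\rangle\langle\phi_d^+|_{AB'}\otimes\rho_{B''}$$ and $$U_B\,B_i\,U_B^{\dagger}=A_i^{*}\otimes\mathbb{1}_{B''}\qquad\text{for all } i=1,\dots,N.$$
   Context: A set of unitary operators $A_1,\dots,A_N$ on $\mathbb{C}^d$ with $A_i^d=\mathbb{1}_d$ is called genuinely incompatible if there is no nonzero subspace $V\subset\mathbb{C}^d$ with $\dim V<d$ such that $A_iV\subseteq V$ for all $i$. A $d$-outcome quantum measurement on $\mathcal{H}_B$ is a family of positive semidefinite operators $N_{0},\dots,N_{d-1}$ with $\sum_b N_b=\mathbb{1}$; it is projective if the $N_b$ are mutually orthogonal projections. $|\phi_d^+\rangle=\frac{1}{\sqrt d}\sum_{i=0}^{d-1}|i\rangle|i\rangle$ is the maximally entangled state of two qudits (in the standard basis), and $A_i^*$ denotes the entrywise complex conjugate of $A_i$ in the standard basis. The number $N(d-1)$ is the maximal quantum value (and the algebraic maximum) of $\mathcal{B}_{d,N}$. *)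

(* Defs.v *)
From mathcomp Require Export all_boot all_order all_algebra.
From mathcomp Require Export reals trigo.
From mathcomp.real_closed Require Export complex mxtens.

Set Implicit Arguments.
Unset Strict Implicit.
Unset Printing Implicit Defensive.

Export Order.TTheory GRing.Theory Num.Theory.
Open Scope ring_scope.
Open Scope sesquilinear_scope.

(* Operators act on column vectors: M : 'M_(p, n) is a map C^n -> C^p.
   C^m (x) C^n is C^(m * n), with |i>|j> the basis vector of index
   mxtens_index (i, j) = i * n + j, so that *t is the tensor product. *)

Definition omega (R : realType) (d : nat) : R[i] :=
  Complex (cos (2 * pi / d%:R)) (sin (2 * pi / d%:R)).

(* [0 <= z] in a numClosedFieldType means that z is real and nonnegative; in
   particular a positive semidefinite operator is Hermitian. *)
Definition psdmx (C : numClosedFieldType) (n : nat) (M : 'M[C]_n) : Prop :=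
  forall v : 'cV[C]_n, 0 <= (v^t* *m M *m v) 0 0.

Definition density (C : numClosedFieldType) (n : nat) (rho : 'M[C]_n) : Prop :=
  psdmx rho /\ \tr rho = 1.

Definition ptraceA (C : pzRingType) (m n : nat) (rho : 'M[C]_(m * n)) : 'M[C]_n :=
  \matrix_(j, k) \sum_(i < m) rho (mxtens_index (i, j)) (mxtens_index (i, k)).

Definition measurement (C : numClosedFieldType) (d n : nat)
    (P : 'I_d -> 'M[C]_n) : Prop :=
  (forall b, psdmx (P b)) /\ \sum_b P b = 1%:M.

Definition projective (C : numClosedFieldType) (d n : nat)
    (P : 'I_d -> 'M[C]_n) : Prop :=
  (forall b, (P b)^t* = P b /\ P b *m P b = P b) /\
  (forall b b', b != b' -> P b *m P b' = 0).

Definition genuinely_incompatible (C : fieldType) (d N : nat)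
    (A : 'I_N -> 'M[C]_d) : Prop :=
  ~ exists V : {vspace 'cV[C]_d},
      [/\ V != 0%VS, (\dim V < d)%N &
          forall i v, v \in V -> A i *m v \in V].

Definition observable (R : realType) (d n : nat) (P : 'I_d -> 'M[R[i]]_n)
    (k : nat) : 'M[R[i]]_n :=
  \sum_(b < d) omega R d ^+ (b * k) *: P b.

Definition steering_functional (R : realType) (d N n : nat)
    (A : 'I_N -> 'M[R[i]]_d) (P : 'I_N -> 'I_d -> 'M[R[i]]_n)
    (rho : 'M[R[i]]_(d * n)) : R[i] :=
  \sum_(i < N) \sum_(1 <= k < d)
    \tr ((A i ^+ k *t observable (P i) k) *m rho).

Definition max_entangled (C : numClosedFieldType) (d : nat) : 'cV[C]_(d * d) :=
  (sqrtC d%:R)^-1 *: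
    \sum_(i < d) ((delta_mx i 0 : 'cV[C]_d) *t (delta_mx i 0 : 'cV[C]_d)).

(* |phi_d^+><phi_d^+|_{AB'} (x) sigma, regrouped from (A B') B'' to A (B' B''). *)
Definition max_entangled_tens (C : numClosedFieldType) (d m : nat)
    (sigma : 'M[C]_m) : 'M[C]_(d * (d * m)) :=
  castmx (esym (mulnA d d m), esym (mulnA d d m))
    ((max_entangled C d *m (max_entangled C d)^t*) *t sigma).

(* Main.v *)
Require Import Defs.
From mathcomp Require Import ring lra.

(* Each E_b := d^-1 sum_k (omega^b A_i)^k is an orthogonal projection, and
   sum_k A_i^k (x) B_{k|i} = d sum_b E_b (x) N_{b|i}.  Hence maximal violation
   forces Tr[((1 - E_b) (x) N_{b|i}) rho] = 0, and by positivity
   (1 (x) N_{b|i}) rho = (E_b (x) 1) rho.  The orthogonality of the E_b thus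
   passes to the N_{b|i} (rho_B has full rank), and (A_i (x) B_i) rho = rho.
   Reading the vectors of an orthonormal basis of the range of rho as d x n
   matrices Psi_k, one gets A_i Psi_k B_i^T = Psi_k, so Psi_k Psi_l^* commutes
   with all A_i and is scalar by Schur's lemma.  Therefore the rows of the
   sqrt(d) Psi_k are orthonormal; they span C^n since rho_B has full rank, and
   their conjugates are the rows of U_B. *)

Set Implicit Arguments.
Unset Strict Implicit.
Unset Printing Implicit Defensive.

(** * Adjoints, Gram factorizations and positivity of traces *)

Section Adjoint.
Variable C : numClosedFieldType.

Lemma adjmxM m n p (X : 'M[C]_(m, n)) (Y : 'M[C]_(n, p)) :
  (X *m Y)^t* = Y^t* *m X^t*.
Proof. by rewrite trmx_mul map_mxM. Qed.

Lemma adjmxD m n (X Y : 'M[C]_(m, n)) : (X + Y)^t* = X^t* + Y^t*.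
Proof. by rewrite linearD map_mxD. Qed.

Lemma adjmxZ m n a (X : 'M[C]_(m, n)) : (a *: X)^t* = a^* *: X^t*.
Proof. by rewrite linearZ map_mxZ. Qed.

Lemma adjmx1 n : (1%:M : 'M[C]_n)^t* = 1%:M.
Proof. by rewrite trmx1 map_mx1. Qed.

Lemma adjmx_tens m n p q (X : 'M[C]_(m, n)) (Y : 'M[C]_(p, q)) :
  (X *t Y)^t* = X^t* *t Y^t*.
Proof. by rewrite trmx_tens map_mxT. Qed.

Lemma trace_adjmx_ge0 m n (X : 'M[C]_(m, n)) : 0 <= \tr (X^t* *m X).
Proof.
apply: sumr_ge0 => i _; rewrite mxE; apply: sumr_ge0 => j _.
by rewrite !mxE mulrC mul_conjC_ge0.
Qed.

Lemma trace_adjmx_eq0 m n (X : 'M[C]_(m, n)) : \tr (X^t* *m X) = 0 -> X = 0.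
Proof.
have ge0 i j : 0 <= X^t* i j * X j i by rewrite !mxE mulrC mul_conjC_ge0.
move/eqP; rewrite psumr_eq0; last first.
  by move=> i _; rewrite mxE; apply: sumr_ge0.
move/allP=> X0; apply/matrixP=> j i; have := X0 i (mem_index_enum i).
rewrite /= mxE psumr_eq0 // => /allP /(_ j (mem_index_enum j)).
by rewrite /= !mxE mulrC mul_conjC_eq0 => /eqP.
Qed.

(** Polarization shows that [M] is Hermitian; in a unitary eigenbasis [S] the eigenvalues [l] are
    nonnegative, and [G] is [sqrt(l) S]. *)
Lemma psdmx_gram n (M : 'M[C]_n) : psdmx M -> exists G : 'M[C]_n, M = G^t* *m G.
Proof.
move=> psdM.
have entry (a b : 'I_n) c d' : ((c *: delta_mx a 0 : 'cV[C]_n)^t* *m M *m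
    (d' *: delta_mx b 0 : 'cV[C]_n)) 0 0 = c^* * d' * M a b.
  rewrite adjmxZ -scalemxAr -scalemxAl -scalemxAl trmx_delta map_delta_mx.
  by rewrite -rowE -colE !mxE; ring.
(* This is the quadratic form of [M] at the vector [e_a + c e_b]. *)
have real (a b : 'I_n) c :
    M a a + c * M a b + c^* * M b a + c^* * c * M b b \is Num.real.
  apply: ger0_real; have := psdM (1 *: delta_mx a 0 + c *: delta_mx b 0).
  have sum00 (X Y : 'M[C]_1) : (X + Y) 0 0 = X 0 0 + Y 0 0 by rewrite mxE.
  rewrite adjmxD !mulmxDr !mulmxDl !sum00 !entry; congr (0 <= _).
  by rewrite rmorph1; ring.
have diag a : M a a \is Num.real.
  by have := real a a 0; rewrite rmorph0 !mul0r !addr0.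
have herm : M \is hermsymmx.
  apply/is_hermitianmxP; rewrite /= expr0 scale1r; apply/matrixP=> a b.
  rewrite !mxE.
  have rc c : c * M a b + c^* * M b a \is Num.real.
    have -> : c * M a b + c^* * M b a =
        (M a a + c * M a b + c^* * M b a + c^* * c * M b b)
          - M a a - c^* * c * M b b by ring.
    rewrite rpredB ?rpredB // rpredM // mulrC; apply: ger0_real; exact: mul_conjC_ge0.
  (* The choice [c = 1] makes [M a b + M b a] real and [c = 'i] makes [M a b - M b a] purely
     imaginary; half their sum gives [M a b = (M b a)^*]. *)
  have /CrealP := rc 1; have /CrealP := rc 'i.
  rewrite !rmorphD !rmorphM !conjC1 /= !mul1r conjCK conjCi !mulNr => hi h1.
  have hi' : M a b - M b a = (M b a)^* - (M a b)^*.
    apply: (mulfI (neq0Ci C)); rewrite !mulrBr -hi; ring.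
  have two : (2 : C) != 0 by rewrite pnatr_eq0.
  apply: (mulfI two).
  have -> : 2 * M a b = (M a b + M b a) + (M a b - M b a) by ring.
  by rewrite hi' -h1; ring.
have /orthomx_spectralP Msp := hermitian_normalmx herm.
set S := spectralmx M in Msp; set l := spectral_diag M in Msp.
have Su : S \is unitarymx := spectral_unitarymx M.
have SS : S *m S^t* = 1%:M by apply/unitarymxP.
have l_ge0 i : 0 <= l 0 i.
  (* The test vector is the [i]-th eigenvector, where the form takes the value [l 0 i]. *)
  have := psdM (S^t* *m delta_mx i 0); rewrite {1}Msp invmx_unitary //.
  rewrite adjmxM trmxCK !mulmxA -!(mulmxA _ S) SS !mulmx1.
  rewrite trmx_delta map_delta_mx.
  by rewrite -colE -rowE !mxE eqxx mulr1n.
exists (diag_mx (map_mx sqrtC l) *m S).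
rewrite adjmxM {1}Msp invmx_unitary // !mulmxA -(mulmxA _ (_^t*)).
congr (_ *m _ *m _).
rewrite tr_diag_mx map_diag_mx mulmx_diag; congr diag_mx.
apply/rowP=> i; rewrite !mxE /= geC0_conj ?sqrtC_ge0 //.
by rewrite -expr2 sqrtCK.
Qed.

Lemma psdmx_conjugate m n (X : 'M[C]_(m, n)) (M : 'M[C]_n) :
  psdmx M -> psdmx (X *m M *m X^t*).
Proof.
by move=> psdM v; have := psdM (X^t* *m v); rewrite adjmxM trmxCK !mulmxA.
Qed.

(** With [N] and [rho] factored through [H] and [K], the trace is the squared Hilbert-Schmidt norm
    of [G *t H *m K^t*]. It vanishes only if this matrix does, which turns a scalar equality into an
    operator equality. *)
Lemma psd_tens_trace m n (G : 'M[C]_m) (N : 'M[C]_n) (rho : 'M[C]_(m * n)) :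
    psdmx N -> psdmx rho ->
  0 <= \tr ((G^t* *m G) *t N *m rho) /\
  (\tr ((G^t* *m G) *t N *m rho) = 0 -> (G^t* *m G) *t N *m rho = 0).
Proof.
move=> /psdmx_gram[H ->] /psdmx_gram[K ->].
have -> : \tr ((G^t* *m G) *t (H^t* *m H) *m (K^t* *m K)) =
    \tr ((G *t H *m K^t*)^t* *m (G *t H *m K^t*)).
  by rewrite -tensmx_mul -adjmx_tens mulmxA mxtrace_mulC adjmxM trmxCK !mulmxA.
split; first exact: trace_adjmx_ge0.
move/trace_adjmx_eq0 => GHK0.
by rewrite -tensmx_mul -!mulmxA (mulmxA (G *t H)) GHK0 mul0mx mulmx0.
Qed.

End Adjoint.

(** * Roots of unity *)

Lemma omegaX (R : realType) (d k : nat) :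
  omega R d ^+ k =
    Complex (cos (2 * pi / d%:R * k%:R)) (sin (2 * pi / d%:R * k%:R)).
Proof.
rewrite /omega; set t := _ / _.
elim: k => [|k IHk]; first by rewrite expr0 mulr0 cos0 sin0.
rewrite exprS IHk -[k.+1%:R]nat1r mulrDr mulr1 cosD sinD.
by apply/eqP; rewrite eq_complex /= [X in _ && (X == _)]addrC addrC !eqxx.
Qed.

Lemma omega_primitive (R : realType) (d : nat) :
  (0 < d)%N -> d.-primitive_root (omega R d).
Proof.
move=> d_gt0; have d0 : d%:R != 0 :> R by rewrite pnatr_eq0 -lt0n.
have omega1 : omega R d ^+ d = 1.
  by rewrite omegaX divfK // mulr_natl cos2pi sin2pi.
rewrite /primitive_root_of_unity d_gt0; apply/forallP => k.
rewrite unity_rootE; case: (ltngtP k.+1 d) (ltn_ord k) => // [kd _|->]; last first.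
  by rewrite omega1 eqxx.
rewrite eqbF_neg omegaX eq_complex /= negb_and; apply/orP; left.
(* Half the angle of the power: [x] lies strictly between 0 and pi, so
   [cos (2x) = 1 - 2 sin^2 x < 1]. *)
set x := pi / d%:R * k.+1%:R :> R.
have -> : 2 * pi / d%:R * k.+1%:R = x + x by rewrite /x; field.
have : 0 < sin x.
  apply: sin_gt0_pi; rewrite mulr_gt0 ?divr_gt0 ?pi_gt0 ?ltr0n //=.
  by rewrite /x mulrAC ltr_pdivrMr ?ltr0n // ltr_pM2l ?pi_gt0 // ltr_nat.
move=> s0; rewrite cosD -!expr2 cos2sin2 neq_lt; apply/orP; left.
have := exprn_gt0 2 s0; lra.
Qed.

(** * Bilinearity of the tensor product *)

Lemma tensmx_suml (R : pzRingType) (I : finType) m n p q (F : I -> 'M[R]_(m, n))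
    (Y : 'M[R]_(p, q)) : (\sum_i F i) *t Y = \sum_i F i *t Y.
Proof.
apply/matrixP=> i j; rewrite summxE mxE summxE mulr_suml.
by apply: eq_bigr => k _; rewrite mxE.
Qed.

Lemma tensmx_sumr (R : pzRingType) (I : finType) m n p q (X : 'M[R]_(m, n))
    (F : I -> 'M[R]_(p, q)) : X *t (\sum_i F i) = \sum_i X *t F i.
Proof.
apply/matrixP=> i j; rewrite summxE mxE summxE mulr_sumr.
by apply: eq_bigr => k _; rewrite mxE.
Qed.

Lemma tensmxZl (R : pzRingType) m n p q a (X : 'M[R]_(m, n)) (Y : 'M[R]_(p, q)) :
  (a *: X) *t Y = a *: (X *t Y).
Proof. by apply/matrixP=> i j; rewrite !mxE mulrA. Qed.

Lemma tensmxZr (R : comPzRingType) m n p q a (X : 'M[R]_(m, n))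
    (Y : 'M[R]_(p, q)) : X *t (a *: Y) = a *: (X *t Y).
Proof. by apply/matrixP=> i j; rewrite !mxE mulrCA. Qed.

Lemma tensmxBl (R : pzRingType) m n p q (X X' : 'M[R]_(m, n)) (Y : 'M[R]_(p, q)) :
  (X - X') *t Y = X *t Y - X' *t Y.
Proof. by apply/matrixP=> i j; rewrite !mxE mulrBl. Qed.

Lemma tensmx11 (R : pzRingType) m n :
  (1%:M : 'M[R]_m) *t (1%:M : 'M[R]_n) = 1%:M.
Proof.
apply/matrixP=> i j; case: (mxtens_indexP i) => a b; case: (mxtens_indexP j) => a' b'.
rewrite tensmxE !mxE -natrM mulnb (inj_eq (can_inj (@mxtens_indexK _ _))).
by rewrite xpair_eqE.
Qed.

(** * Averages over the powers of a unitary of finite order *)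

Section CyclicAverage.
Variables (C : numClosedFieldType) (p d : nat).
Hypothesis d_gt0 : (0 < d)%N.

(** For unitary [A] with [A ^+ d = 1], this is the orthogonal projection onto the vectors fixed by
    [A]. *)
Definition cyclic_avg (A : 'M[C]_p) : 'M[C]_p := d%:R^-1 *: \sum_(k < d) A ^+ k.

Variable A : 'M[C]_p.
Hypotheses (A_unitary : A \is unitarymx) (A_order : A ^+ d = 1%:M).
Let E := cyclic_avg A.

Let adjA : A^t* *m A = 1%:M.
Proof. by apply: mulmx1C; apply/unitarymxP. Qed.

Lemma mul_cyclic_avg : A *m E = E.
Proof.
rewrite /E /cyclic_avg -scalemxAr; congr (_ *: _).
case: d d_gt0 A_order => // d' _ Ad.
(* Multiplication by [A] shifts the powers cyclically: the last term on the left becomes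
   [A ^+ d = 1], the first term on the right. *)
rewrite mulmx_sumr big_ord_recr [RHS]big_ord_recl /= addrC expr0.
rewrite [X in X + _ = _](_ : _ = 1) ?[X in X = _ -> _]Ad; last by rewrite -[LHS]exprS.
by congr (_ + _); apply: eq_bigr => k _; rewrite [RHS]exprS.
Qed.

Lemma cyclic_avg_comm (X : 'M[C]_p) : A *m X = X *m A -> E *m X = X *m E.
Proof.
move=> AX; rewrite /E /cyclic_avg -scalemxAr -scalemxAl; congr (_ *: _).
rewrite mulmx_suml mulmx_sumr; apply: eq_bigr => k _.
have cXA : GRing.comm X A by [].
exact/esym/commrX.
Qed.

(** Since [A] fixes [E], so do its adjoint and the powers of that adjoint; the product is an average
    of [d] copies of [E]. *)
Lemma cyclic_avg_proj : E^t* *m E = E.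
Proof.
have AkE k : (A ^+ k)^t* *m E = E.
  elim: k => [|k IHk]; first by rewrite expr0 adjmx1 mul1mx.
  rewrite exprS [A * _]/(A *m _) adjmxM -mulmxA -[X in _ *m (_ *m X)]mul_cyclic_avg.
  by rewrite (mulmxA _ A) adjA mul1mx.
rewrite {1}/E /cyclic_avg adjmxZ linear_sum /= map_mx_sum.
rewrite -scalemxAl mulmx_suml (eq_bigr (fun=> E)) ?sumr_const ?card_ord; last first.
  by move=> k _; apply: AkE.
rewrite -scaler_nat scalerA geC0_conj ?invr_ge0 ?ler0n // mulVf ?scale1r //.
by rewrite pnatr_eq0 -lt0n.
Qed.

Lemma cyclic_avg_adj : E^t* = E.
Proof. by rewrite -{1}cyclic_avg_proj adjmxM trmxCK cyclic_avg_proj. Qed.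

Lemma cyclic_avg_id : E *m E = E.
Proof. by rewrite -{1}cyclic_avg_adj cyclic_avg_proj. Qed.

(** The complementary projection in the Gram form that [psd_tens_trace] expects. *)
Lemma cyclic_avg_compl_gram : 1%:M - E = (1%:M - E)^t* *m (1%:M - E).
Proof.
rewrite -[- E]scaleN1r adjmxD adjmxZ adjmx1 rmorphN1 !scaleN1r cyclic_avg_adj.
by rewrite mulmxBl !mulmxBr !mulmx1 !mul1mx cyclic_avg_id subrr subr0.
Qed.

End CyclicAverage.

(** * Tensor indices and the partial trace *)

Lemma big_mxtens_index (R : nmodType) m n (F : 'I_(m * n) -> R) :
  \sum_s F s = \sum_i \sum_j F (mxtens_index (i, j)).
Proof.
rewrite pair_big /= (reindex (@mxtens_index m n)) /=; last first.
  by exists (@mxtens_unindex m n) => s _; [apply: mxtens_indexK|apply: mxtens_unindexK].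
by apply: eq_bigr => -[].
Qed.

Lemma tens1mx_mulE (R : comPzRingType) d m n p (Y : 'M[R]_(m, n))
    (X : 'M[R]_(d * n, p)) i j s :
  (1%:M *t Y *m X) (mxtens_index (i, j)) s = \sum_l Y j l * X (mxtens_index (i, l)) s.
Proof.
rewrite mxE big_mxtens_index (bigD1 i) //= [X in _ + X]big1 ?addr0.
  by apply: eq_bigr => l _; rewrite tensmxE mxE eqxx mul1r.
move=> k ki; apply: big1 => l _.
by rewrite tensmxE mxE eq_sym (negbTE ki) !mul0r.
Qed.

Lemma ptraceA_mull (R : comPzRingType) d n (Y : 'M[R]_n) (rho : 'M[R]_(d * n)) :
  ptraceA (1%:M *t Y *m rho) = Y *m ptraceA rho.
Proof.
apply/matrixP=> j k; rewrite !mxE.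
under eq_bigr do rewrite tens1mx_mulE.
rewrite exchange_big; apply: eq_bigr => l _.
by rewrite mxE mulr_sumr.
Qed.

(** Tracing out Alice leaves [Y *m ptraceA rho = Z *m ptraceA rho], and the full-rank reduced state
    cancels on the right. *)
Lemma ptraceA_full_inj (F : fieldType) d n (Y Z : 'M[F]_n) (rho : 'M[F]_(d * n)) :
    \rank (ptraceA rho) = n ->
  1%:M *t Y *m rho = 1%:M *t Z *m rho -> Y = Z.
Proof.
move=> rk YZ; have free : row_free (ptraceA rho) by apply/eqP.
by apply: (row_free_inj free); rewrite -!ptraceA_mull YZ.
Qed.

Lemma exprZmx (R : comPzRingType) n a (X : 'M[R]_n) k :
  (a *: X) ^+ k = a ^+ k *: X ^+ k.
Proof.
elim: k => [|k IHk]; first by rewrite !expr0 scale1r.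
rewrite !exprS IHk; transitivity ((a *: X) *m (a ^+ k *: X ^+ k)) => //.
by rewrite -scalemxAl -scalemxAr scalerA.
Qed.

(** * Maximal violation for a single pair of measurements *)

Section SteeringStep.
Variables (C : numClosedFieldType) (d n : nat) (w : C).
Hypotheses (d_gt0 : (0 < d)%N) (w_prim : d.-primitive_root w).
Variable A : 'M[C]_d.
Hypotheses (A_unitary : A \is unitarymx) (A_order : A ^+ d = 1%:M).
Variable P : 'I_d -> 'M[C]_n.
Hypothesis P_meas : measurement P.
Variable rho : 'M[C]_(d * n).
Hypothesis rho_psd : psdmx rho.

Local Notation wA b := (w ^+ b *: A).
Local Notation E b := (cyclic_avg d (wA b)).

Lemma conj_prim_root : w^* * w = 1.
Proof.
rewrite mulrC -normCK; suff -> : `|w| = 1 by rewrite expr1n.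
by apply/eqP; rewrite -(pexpr_eq1 d_gt0) // -normrX prim_expr_order // normr1.
Qed.

Lemma twist_unitary b : wA b \is unitarymx.
Proof.
apply/unitarymxP; rewrite adjmxZ -scalemxAl -scalemxAr scalerA.
rewrite (unitarymxP A_unitary) rmorphXn -exprMn [_ * _]mulrC /=.
by rewrite conj_prim_root expr1n scale1r.
Qed.

Lemma twist_order b : wA b ^+ d = 1%:M.
Proof. by rewrite exprZmx A_order exprAC (prim_expr_order w_prim) expr1n scale1r. Qed.

Lemma twist_avg_comm b : A *m E b = E b *m A.
Proof. by apply/esym/cyclic_avg_comm; rewrite -scalemxAl -scalemxAr. Qed.

Lemma mul_twist_avg b : w ^+ b *: (A *m E b) = E b.
Proof. by rewrite scalemxAl; exact: (mul_cyclic_avg d_gt0 (twist_order b)). Qed.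

(** The columns of the product would be eigenvectors of [A] for both [w ^- b] and [w ^- b'], which
    differ because [w] is primitive. *)
Lemma twist_avg_orth (b b' : 'I_d) : b != b' -> E b *m E b' = 0.
Proof.
move=> bb'; set Z := _ *m _.
have h1 : w ^+ b *: (A *m Z) = Z by rewrite mulmxA scalemxAl mul_twist_avg.
have h2 : w ^+ b' *: (A *m Z) = Z.
  by rewrite mulmxA twist_avg_comm -mulmxA scalemxAr mul_twist_avg.
have : (w ^+ b - w ^+ b') *: (A *m Z) = 0 by rewrite scalerBl h1 h2 subrr.
move/eqP; rewrite scaler_eq0 subr_eq0 (eq_prim_root_expr w_prim).
rewrite !modn_small ?ltn_ord // (inj_eq val_inj) (negbTE bb') /= => /eqP AZ0.
by rewrite -h1 AZ0 scaler0.
Qed.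

(** Contains the [k = 0] term, which the steering functional omits, so that the full cyclic averages
    appear. *)
Definition steering_value : C :=
  \sum_(k < d) \tr ((A ^+ k *t \sum_(b < d) w ^+ (b * k) *: P b) *m rho).

(** Exchanging the sums over [k] and [b] collects the powers of [w ^+ b *: A] into [d] times [E b];
    completeness of [P] then isolates the complements, whose traces measure the distance to the
    maximum. *)
Lemma steering_value_defect :
  steering_value = d%:R * (\tr rho -
    \sum_(b < d) \tr ((1%:M - E b) *t P b *m rho)).
Proof.
have -> : steering_value = d%:R * \sum_(b < d) \tr (E b *t P b *m rho).
  rewrite /steering_value; under eq_bigr => k _.
    rewrite tensmx_sumr mulmx_suml linear_sum /=; over.
  rewrite exchange_big mulr_sumr; apply: eq_bigr => b _.
  rewrite /cyclic_avg tensmxZl -scalemxAl linearZ /= mulrA divff ?mul1r; last first.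
    by rewrite pnatr_eq0 -lt0n.
  rewrite tensmx_suml mulmx_suml linear_sum; apply: eq_bigr => k _ /=.
  by rewrite exprZmx tensmxZl tensmxZr exprM.
congr (_ * _); apply/esym/eqP; rewrite subr_eq; apply/eqP.
rewrite -big_split /= -[LHS]mulr1 mulr1.
rewrite -[in LHS](mul1mx rho) -(tensmx11 _ d n) -(proj2 P_meas) tensmx_sumr.
rewrite mulmx_suml linear_sum; apply: eq_bigr => b _ /=.
by rewrite tensmxBl mulmxBl linearB /= addrC subrK.
Qed.

Lemma defect_ge0 (b : 'I_d) : 0 <= \tr ((1%:M - E b) *t P b *m rho).
Proof.
rewrite (cyclic_avg_compl_gram d_gt0 (twist_unitary b) (twist_order b)).
by apply (psd_tens_trace _ (proj1 P_meas b) rho_psd).1.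
Qed.

(** * Operator relations on the state when all defects vanish *)

Hypothesis no_defect : forall b : 'I_d, \tr ((1%:M - E b) *t P b *m rho) = 0.

Lemma measurement_twist_avg (b : 'I_d) : 1%:M *t P b *m rho = E b *t P b *m rho.
Proof.
apply/eqP; rewrite -subr_eq0 -mulmxBl -tensmxBl; apply/eqP; move: (no_defect b).
rewrite (cyclic_avg_compl_gram d_gt0 (twist_unitary b) (twist_order b)).
exact: (psd_tens_trace _ (proj1 P_meas b) rho_psd).2.
Qed.

(** Inserting [\sum_b' P b' = 1] on the right, the terms with [b' != b] acquire a factor
    [E b *m E b' = 0], and the term [b] is [measurement_twist_avg]. *)
Lemma steering_transfer (b : 'I_d) : 1%:M *t P b *m rho = E b *t 1%:M *m rho.
Proof.
rewrite measurement_twist_avg -(proj2 P_meas) tensmx_sumr mulmx_suml (bigD1 b) //=.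
rewrite big1 ?addr0 // => b' bb'.
rewrite tensmx_decr -mulmxA measurement_twist_avg mulmxA tensmx_mul twist_avg_orth //.
  by rewrite tens0mx mul0mx.
by rewrite eq_sym.
Qed.

(** For each [b], transferring [P b] to Alice gives [w ^+ b *: A] times [E b], which is [E b] again;
    transferring back and summing over [b] restores [rho]. *)
Lemma steering_stabilizer :
  A *t (\sum_(b < d) w ^+ b *: P b) *m rho = rho.
Proof.
rewrite -[RHS]mul1mx -(tensmx11 _ d n) -(proj2 P_meas).
rewrite !tensmx_sumr !mulmx_suml; apply: eq_bigr => b _.
rewrite tensmxZr -tensmxZl tensmx_decr -mulmxA steering_transfer mulmxA.
by rewrite tensmx_mul mulmx1 (mul_cyclic_avg d_gt0 (twist_order b)).
Qed.

Hypothesis rhoB_full : \rank (ptraceA rho) = n.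

Lemma steering_projective : projective P.
Proof.
(* Transfer reverses the order of products: the factor nearest to [rho] moves first and then
   commutes past the remaining Bob operator. *)
have mulP b b' : 1%:M *t (P b' *m P b) *m rho = (E b *m E b') *t 1%:M *m rho.
  rewrite -[X in X *t _]mulmx1 -tensmx_mul -mulmxA steering_transfer mulmxA.
  rewrite -tensmx_decl tensmx_decr -mulmxA steering_transfer mulmxA.
  by rewrite tensmx_mul mulmx1.
split=> [b|b b' bb'].
  split.
    have [G ->] := psdmx_gram (proj1 P_meas b).
    by rewrite adjmxM trmxCK.
  apply: (ptraceA_full_inj rhoB_full).
  rewrite mulP (cyclic_avg_id d_gt0 (twist_unitary b) (twist_order b)).
  by rewrite -steering_transfer.
apply: (ptraceA_full_inj rhoB_full).
by rewrite mulP twist_avg_orth 1?eq_sym // tens0mx tensmx0.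
Qed.

End SteeringStep.

(** * Functional calculus of a projective measurement, and Schur's lemma *)

Lemma projective_sum_mul (C : numClosedFieldType) d n (P : 'I_d -> 'M[C]_n) f g :
    projective P ->
  (\sum_b f b *: P b) *m (\sum_b g b *: P b) = \sum_b (f b * g b) *: P b.
Proof.
move=> [PP P0]; rewrite mulmx_suml; apply: eq_bigr => b _.
rewrite mulmx_sumr (bigD1 b) //= big1 ?addr0.
  by rewrite -scalemxAl -scalemxAr scalerA (PP b).2.
by move=> b' bb'; rewrite -scalemxAl -scalemxAr P0 1?eq_sym // !scaler0.
Qed.

Lemma tensmx1_mulE (R : comPzRingType) d e m p (X : 'M[R]_(d, e))
    (Y : 'M[R]_(e * m, p)) i k s :
  (X *t 1%:M *m Y) (mxtens_index (i, k)) s = \sum_j X i j * Y (mxtens_index (j, k)) s.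
Proof.
rewrite mxE big_mxtens_index; apply: eq_bigr => j _.
rewrite (bigD1 k) //= big1 ?addr0; first by rewrite tensmxE mxE eqxx mulr1.
by move=> l lk; rewrite tensmxE mxE eq_sym (negbTE lk) mulr0 mul0r.
Qed.

(** An eigenspace of [X] is nonzero and invariant under every [A i], so incompatibility forces it to
    be the whole space. *)
Lemma commutant_scalar (C : numClosedFieldType) d N (A : 'I_N -> 'M[C]_d)
    (X : 'M[C]_d) :
    (0 < d)%N -> genuinely_incompatible A ->
  (forall i, A i *m X = X *m A i) -> exists c, X = c%:M.
Proof.
move=> d_gt0 incA comm.
(* [eigenvalue] refers to row vectors; the transpose provides a column eigenvector [v^T] of [X]. *)
have [a /eigenvalueP[v vX v0]] := eigenvalue_closed X^T d_gt0.
exists a.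
pose V := lker (linfun (mulmx (X - a%:M) : 'cV[C]_d -> 'cV[C]_d)).
have inV u : (u \in V) = (X *m u == a *: u).
  by rewrite memv_ker lfunE /= mulmxBl mul_scalar_mx subr_eq0.
have dimC : \dim {: 'cV[C]_d} = d by rewrite dimvf /dim /= muln1.
have VT : V = fullv.
  apply/eqP; rewrite eqEdim subvf /= dimC leqNgt; apply/negP => dimV.
  apply: incA; exists V; split=> //.
    apply/eqP => V0; have : v^T \in V.
      by rewrite inV -[X]trmxK -trmx_mul vX linearZ.
    by rewrite V0 memv0 trmx_eq0 (negbTE v0).
  move=> i u; rewrite !inV => /eqP Xu.
  by rewrite mulmxA -comm -mulmxA Xu scalemxAr.
apply/matrixP=> i j; pose e : 'cV[C]_d := delta_mx j 0.
have /eqP Xj : X *m e == a *: e by rewrite -inV VT memvf.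
have := congr1 (fun u : 'cV[C]_d => u i 0) Xj.
by rewrite /e -colE !mxE eqxx andbT => ->; rewrite mulr_natr.
Qed.

(** * Structure of a state stabilized by all [A i *t B i] *)

Section Structure.
Variables (C : numClosedFieldType) (d N n : nat).
Hypothesis d_gt0 : (0 < d)%N.
Variable A : 'I_N -> 'M[C]_d.
Hypotheses (A_unitary : forall i, A i \is unitarymx)
  (A_incompatible : genuinely_incompatible A).
Variable B : 'I_N -> 'M[C]_n.
Hypothesis B_unitary : forall i, B i \is unitarymx.
Variable rho : 'M[C]_(d * n).
Hypotheses (rho_density : density rho) (rhoB_full : \rank (ptraceA rho) = n).
Hypothesis rho_stab : forall i, A i *t B i *m rho = rho.

Let s0 : sqrtC d%:R != 0 :> C.
Proof. by rewrite sqrtC_eq0 pnatr_eq0 -lt0n. Qed.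

Let sC : (sqrtC d%:R : C)^* = sqrtC d%:R.
Proof. by rewrite geC0_conj // sqrtC_ge0 ler0n. Qed.

Section Support.
Variables (m : nat) (K : 'M[C]_(d * n, m)).
Hypotheses (K_isometry : K^t* *m K = 1%:M)
  (K_stab : forall i, A i *t B i *m K = K).

(* The vectors K(-, k) of C^d (x) C^n read as d x n matrices, so that
   A (x) B acts by Psi |-> A Psi B^T. *)
Definition reshape_col k : 'M[C]_(d, n) :=
  \matrix_(i, j) K (mxtens_index (i, j)) k.
Local Notation Psi := reshape_col.

Lemma reshape_col_stab i k : A i *m Psi k *m (B i)^T = Psi k.
Proof.
apply/matrixP=> a b; rewrite [RHS]mxE -[in RHS](K_stab i) !mxE.
rewrite big_mxtens_index exchange_big; apply: eq_bigr => l _.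
rewrite mxE mulr_suml; apply: eq_bigr => j _.
by rewrite tensmxE !mxE mulrAC.
Qed.

(** The unitary [(B i)^T] cancels between the two factors, so the product commutes with every [A i]
    and is scalar. Its trace is the inner product of columns [l] and [k] of [K], which fixes the
    scalar. *)
Lemma reshape_col_gram k l : Psi k *m (Psi l)^t* = ((k == l)%:R / d%:R)%:M.
Proof.
set X := _ *m _.
have AX i : A i *m X = X *m A i.
  have AXA : A i *m X *m (A i)^t* = X.
    rewrite {2}/X -(reshape_col_stab i k) -{1}(reshape_col_stab i l).
    rewrite !adjmxM !mulmxA -(mulmxA _ _^T) (unitarymxP _) ?trmx_unitary //.
    by rewrite mulmx1.
  by rewrite -{2}AXA mulmxKtV.
have [c Xc] := commutant_scalar d_gt0 A_incompatible AX.
have trX : \tr X = (k == l)%:R.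
  have := congr1 (fun Y : 'M[C]_m => Y l k) K_isometry.
  rewrite !mxE eq_sym => <-; rewrite big_mxtens_index.
  apply: eq_bigr => i _; rewrite mxE; apply: eq_bigr => j _.
  by rewrite !mxE mulrC.
move: trX; rewrite Xc mxtrace_scalar => <-.
by rewrite -[c *+ d]mulr_natr mulfK // pnatr_eq0 -lt0n.
Qed.

(** Row [(i, k)] is the conjugate of row [i] of [Psi k], rescaled to norm 1 by [sqrtC d%:R]. *)
Definition bob_iso : 'M[C]_(d * m, n) :=
  \matrix_(s, j) (sqrtC d%:R * (Psi (mxtens_unindex s).2 (mxtens_unindex s).1 j)^*).
Local Notation U := bob_iso.

Lemma bob_isoE i k j : U (mxtens_index (i, k)) j = sqrtC d%:R * (Psi k i j)^*.
Proof. by rewrite mxE mxtens_indexK. Qed.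

(** In vector form, [1 *t U] maps column [l] of [K] to the maximally entangled vector tensored with
    the basis vector [l]. *)
Lemma tens1_bob_iso_mulE i a k l :
  (1%:M *t U *m K) (mxtens_index (i, mxtens_index (a, k))) l =
    (sqrtC d%:R)^-1 * ((i == a) && (k == l))%:R.
Proof.
rewrite tens1mx_mulE.
have -> : \sum_j U (mxtens_index (a, k)) j * K (mxtens_index (i, j)) l =
    sqrtC d%:R * (Psi l *m (Psi k)^t*) i a.
  rewrite !mxE mulr_sumr; apply: eq_bigr => j _.
  by rewrite bob_isoE -mulrA; congr (_ * _); rewrite !mxE mulrC.
have dV : d%:R^-1 = (sqrtC d%:R)^-1 * (sqrtC d%:R)^-1 :> C.
  by rewrite -invfM -expr2 sqrtCK.
rewrite reshape_col_gram mxE -(mulr_natr (_ / _)) [l == k]eq_sym -mulnb natrM dV.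
by rewrite [_%:R * (_ * _)]mulrC -!mulrA mulVKf // [_%:R * _]mulrC.
Qed.

(** Up to the factor [sqrtC d%:R], inner products of rows of [U] are the entries just computed. As
    [U] may still be rectangular, this says only [U *m U^t* = 1]. *)
Lemma bob_iso_unitary : U \is unitarymx.
Proof.
apply/unitarymxP/matrixP=> s t.
case: (mxtens_indexP s) => a k; case: (mxtens_indexP t) => i l.
have -> : (U *m U^t*) (mxtens_index (a, k)) (mxtens_index (i, l)) =
    sqrtC d%:R * (1%:M *t U *m K) (mxtens_index (i, mxtens_index (a, k))) l.
  rewrite tens1mx_mulE mxE mulr_sumr; apply: eq_bigr => j _.
  rewrite [in X in _ * X]mxE [in X in _ * X]mxE [in X in _ * X]bob_isoE.
  by rewrite rmorphM /= conjCK sC !mxE mulrCA.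
rewrite tens1_bob_iso_mulE mulrA divff // mul1r mxE.
by rewrite (inj_eq (can_inj (@mxtens_indexK _ _))) xpair_eqE [i == a]eq_sym.
Qed.

(** Cancelling the unitary [(B i)^T] in the stabilizer relation gives
    [A i *m Psi k = Psi k *m conj (B i)]; the conjugate in the definition of [U] moves the
    conjugation from [B i] to [A i]. *)
Lemma bob_iso_intertwine i : U *m B i = map_mx Num.conj (A i) *t 1%:M *m U.
Proof.
have APsi k : A i *m Psi k = Psi k *m map_mx Num.conj (B i).
  rewrite -[in RHS](reshape_col_stab i k) -mulmxA.
  have -> : (B i)^T *m map_mx Num.conj (B i) = 1%:M.
    have /unitarymxP : (B i)^T \is unitarymx by rewrite trmx_unitary.
    by rewrite trmxK.
  by rewrite mulmx1.
apply/matrixP=> s j; case: (mxtens_indexP s) => a k.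
rewrite tensmx1_mulE mxE.
transitivity (sqrtC d%:R * ((A i *m Psi k) a j)^*).
  rewrite APsi mxE rmorph_sum mulr_sumr; apply: eq_bigr => l _.
  by rewrite bob_isoE rmorphM !mxE /= conjCK mulrA.
rewrite mxE rmorph_sum mulr_sumr; apply: eq_bigr => l _.
by rewrite bob_isoE rmorphM [map_mx _ _ _ _]mxE mulrCA.
Qed.

Lemma bob_iso_state (sigma : 'M[C]_m) :
  (1%:M *t U) *m (K *m sigma *m K^t*) *m (1%:M *t U)^t* =
    max_entangled_tens d sigma.
Proof.
set T := 1%:M *t U *m K.
have -> : (1%:M *t U) *m (K *m sigma *m K^t*) *m (1%:M *t U)^t* = T *m sigma *m T^t*.
  by rewrite /T adjmxM !mulmxA.
have phiE (i a : 'I_d) :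
    max_entangled C d (mxtens_index (i, a)) 0 = (sqrtC d%:R)^-1 * (i == a)%:R.
  rewrite mxE summxE (bigD1 i) //= big1 ?addr0.
    by rewrite mxE mxtens_indexK !mxE !eqxx !ord1 !eqxx !andbT mul1r eq_sym.
  by move=> j ji; rewrite mxE mxtens_indexK !mxE eq_sym (negbTE ji) mul0r.
have TE i a k l : T (mxtens_index (i, mxtens_index (a, k))) l =
    max_entangled C d (mxtens_index (i, a)) 0 * (k == l)%:R.
  by rewrite tens1_bob_iso_mulE phiE -mulrA -natrM mulnb.
have adjE p q (M : 'M[C]_(p, q)) x y : M^t* x y = (M y x)^* by rewrite !mxE.
apply/matrixP=> s t.
case: (mxtens_indexP s) => i s'; case: (mxtens_indexP s') => a k {s s'}.
case: (mxtens_indexP t) => i' t'; case: (mxtens_indexP t') => a' k' {t t'}.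
(* Both groupings of the three indices give the same natural number, so the cast only reassociates
   them. *)
have castE (x y : 'I_d) (z : 'I_m) :
  cast_ord (esym (esym (mulnA d d m))) (mxtens_index (x, mxtens_index (y, z))) =
  mxtens_index (mxtens_index (x, y), z).
  by apply: val_inj; rewrite /= mulnDl mulnA addnA.
rewrite castmxE !castE tensmxE.
rewrite mxE (bigD1 k') //= big1 ?addr0; last first.
  move=> l lk; rewrite adjE TE eq_sym (negbTE lk) mulr0.
  by rewrite rmorph0 mulr0.
rewrite mxE (bigD1 k) //= big1 ?addr0; last first.
  by move=> l lk; rewrite TE eq_sym (negbTE lk) mulr0 mul0r.
rewrite adjE !TE !eqxx !mulr1.
rewrite [X in _ = X * _]mxE big_ord1 adjE.
by rewrite mulrAC.
Qed.

End Support.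

Lemma stabilized_state_structure :
  exists m : nat, n = (d * m)%N /\
    exists (U : 'M[C]_(d * m, n)) (sigma : 'M[C]_m),
      [/\ U *m U^t* = 1%:M /\ U^t* *m U = 1%:M,
          density sigma,
          (1%:M *t U) *m rho *m (1%:M *t U)^t* = max_entangled_tens d sigma &
          forall i, U *m B i *m U^t* = map_mx Num.conj (A i) *t (1%:M : 'M_m)].
Proof.
have [rho_psd tr_rho] := rho_density.
(* Orthonormalization acts on rows, hence the transpose: the columns of [K = Q^T] form an
   orthonormal basis of the range of [rho]. *)
pose Q := schmidt (row_base rho^T).
have Q_unitary : Q \is unitarymx by rewrite schmidt_unitarymx ?rank_leq_col.
have Q_rho : (Q :=: rho^T)%MS.
  apply: eqmx_trans (eq_row_base _).
  by apply: eqmx_schmidt_free; rewrite row_base_free.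
exists (\rank rho^T); set m := \rank _ in Q Q_unitary Q_rho *.
pose K := Q^T.
have KK : K^t* *m K = 1%:M.
  have /unitarymxP : map_mx Num.conj Q \is unitarymx by rewrite conjC_unitary.
  have -> // : (map_mx Num.conj Q)^t* = K by apply/matrixP=> a b; rewrite !mxE conjCK.
  by rewrite /K trmxK.
have [L rhoL] : exists L, rho = K *m L.
  have /submxP[D rhoD] : (rho^T <= Q)%MS by rewrite Q_rho.
  by exists D^T; rewrite -[LHS]trmxK rhoD trmx_mul.
have K_stab i : A i *t B i *m K = K.
  have /submxP[D QD] : (Q <= rho^T)%MS by rewrite Q_rho.
  by rewrite /K QD trmx_mul trmxK mulmxA rho_stab.
have Uu := bob_iso_unitary KK K_stab.
set U := bob_iso K in Uu.
(* Orthonormality of the rows of [U] gives [d * m <= n]; conversely the reduced state, of rank [n],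
   factors through the [d * m] columns of [U^t*]. *)
have nE : n = (d * m)%N.
  apply/eqP; rewrite eqn_leq; apply/andP; split; last first.
    by rewrite -{1}(mxrank_unitary Uu) rank_leq_col.
  pose W : 'M[C]_(d * m, n) :=
    \matrix_(s, j) L (mxtens_unindex s).2 (mxtens_index ((mxtens_unindex s).1, j)).
  have rhoB : ptraceA rho = (sqrtC d%:R)^-1 *: U^t* *m W.
    apply/matrixP=> j l; rewrite !mxE big_mxtens_index; apply: eq_bigr => i _.
    rewrite [rho in LHS]rhoL mxE; apply: eq_bigr => k _.
    rewrite !mxE mxtens_indexK /= rmorphM /= conjCK sC.
    by rewrite mulKf.
  rewrite -{1}rhoB_full rhoB; apply: leq_trans (mxrankM_maxl _ _) _.
  exact: rank_leq_col.
have Krho : K *m K^t* *m rho = rho.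
  by rewrite [rho in LHS]rhoL -mulmxA (mulmxA _ K) KK mul1mx -rhoL.
(* Bob's residual state is the compression of [rho] to its range, written in the basis [K];
   conjugating back by [K] recovers [rho]. *)
split=> //; exists U, (K^t* *m rho *m K); split.
- split; first exact/unitarymxP.
  by rewrite -[LHS]mul1mx mulmxA mulmxKtV.
- split; first by have := psdmx_conjugate (K^t*) rho_psd; rewrite trmxCK.
  by rewrite mxtrace_mulC mulmxA Krho.
- rewrite -(bob_iso_state KK K_stab); congr (_ *m _ *m _).
  have [G rhoG] := psdmx_gram rho_psd.
  have rhoH : rho^t* = rho by rewrite rhoG adjmxM trmxCK.
  have rhoK : rho *m K *m K^t* = rho.
    by rewrite -[RHS]rhoH -{2}Krho !adjmxM trmxCK rhoH mulmxA.
  by rewrite !mulmxA Krho rhoK.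
- by move=> i; rewrite (bob_iso_intertwine K_stab) -mulmxA (unitarymxP Uu) mulmx1.
Qed.

End Structure.

(** * From maximal violation to Bob's measurements and the shared state *)

Theorem theorem1 (R : realType) (d N n : nat) (hd : (2 <= d)%N) (hN : (0 < N)%N)
  (A : 'I_N -> 'M[R[i]]_d)
  (A_unitary : forall i, A i \is unitarymx)
  (A_order : forall i, A i ^+ d = 1%:M)
  (A_incompatible : genuinely_incompatible A)
  (rho : 'M[R[i]]_(d * n))
  (rho_density : density rho)
  (rhoB_full_rank : \rank (ptraceA rho) = n)
  (P : 'I_N -> 'I_d -> 'M[R[i]]_n)
  (P_measurement : forall i, measurement (P i))
  (max_violation : steering_functional A P rho = (N * (d - 1))%:R) :
  let B i := observable (P i) 1 in
  (forall i,
     [/\ projective (P i),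
         forall k : 'I_d, observable (P i) k = B i ^+ k,
         B i \is unitarymx &
         B i ^+ d = 1%:M]) /\
  exists m : nat, n = (d * m)%N /\
    exists (U : 'M[R[i]]_(d * m, n)) (sigma : 'M[R[i]]_m),
      [/\ U *m U^t* = 1%:M /\ U^t* *m U = 1%:M,
          density sigma,
          (1%:M *t U) *m rho *m (1%:M *t U)^t* = max_entangled_tens d sigma &
          forall i, U *m B i *m U^t* = map_mx Num.conj (A i) *t (1%:M : 'M_m)].

Proof.
have d_gt0 : (0 < d)%N by apply: leq_trans hd.
have w_prim := omega_primitive R d_gt0.
have [rho_psd tr_rho] := rho_density.
pose E i (b : 'I_d) := cyclic_avg d (omega R d ^+ b *: A i).
pose defect i b := \tr ((1%:M - E i b) *t P i b *m rho).
have defect_pos i b : 0 <= defect i b by apply: defect_ge0.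
have step i : \sum_(1 <= k < d) \tr ((A i ^+ k *t observable (P i) k) *m rho) =
    (d - 1)%:R - d%:R * \sum_b defect i b.
  have := steering_value_defect (omega R d) d_gt0 (A i) (P_measurement i) rho.
  rewrite tr_rho mulrBr mulr1 /steering_value => value.
  (* The added 1 is the missing [k = 0] term, equal to the trace of [rho]. *)
  apply: (addrI 1); rewrite addrA nat1r subn1 prednK // -{}value.
  rewrite -(big_mkord xpredT (fun k => \tr ((A i ^+ k *t observable (P i) k) *m rho))).
  rewrite big_ltn //; congr (_ + _); rewrite expr0 -[1]tr_rho; congr (\tr _).
  rewrite /observable (eq_bigr (P i)) ?(proj2 (P_measurement i)).
    by rewrite tensmx11 mul1mx.
  by move=> b _; rewrite muln0 expr0 scale1r.
have defect0 i b : defect i b = 0.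
  have : \sum_i \sum_b defect i b = 0.
    have d0 : (d%:R : R[i]) != 0 by rewrite pnatr_eq0 -lt0n.
    (* Summed over [i], [step] gives [N * (d - 1)] minus [d] times the total defect, so attaining
       the maximum makes that total zero; nonnegativity then kills each defect. *)
    apply: (mulfI d0); rewrite mulr0; move: max_violation.
    rewrite /steering_functional (eq_bigr _ (fun i _ => step i)) big_split /=.
    rewrite sumr_const card_ord -mulrnA mulnC -[RHS]addr0 => /addrI /eqP.
    by rewrite sumrN oppr_eq0 -mulr_sumr => /eqP.
  move/eqP; rewrite psumr_eq0; last by move=> j _; apply: sumr_ge0.
  move=> /allP /(_ i (mem_index_enum i)) /=; rewrite psumr_eq0 //.
  by move=> /allP /(_ b (mem_index_enum b)) /eqP.
have proj i : projective (P i).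
  exact: (steering_projective d_gt0 w_prim (A_unitary i) (A_order i)
    (P_measurement i) rho_psd (defect0 i) rhoB_full_rank).
have stab i : A i *t observable (P i) 1 *m rho = rho.
  have := steering_stabilizer d_gt0 w_prim (A_unitary i) (A_order i)
    (P_measurement i) rho_psd (defect0 i).
  by rewrite /observable; under [X in _ -> _ *t X *m _ = _]eq_bigr do rewrite muln1.
have obsX i k : observable (P i) k = observable (P i) 1 ^+ k.
  elim: k => [|k IHk].
    rewrite expr0 -[RHS](proj2 (P_measurement i)).
    by apply: eq_bigr => b _; rewrite muln0 expr0 scale1r.
  rewrite exprS -IHk [RHS](projective_sum_mul _ _ (proj i)).
  by apply: eq_bigr => b _; rewrite -exprD muln1 mulnS.
have obs_unitary i : observable (P i) 1 \is unitarymx.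
  apply/unitarymxP; rewrite /observable linear_sum /= map_mx_sum.
  under [X in _ *m X]eq_bigr => b _ do rewrite adjmxZ ((proj i).1 b).1.
  rewrite (projective_sum_mul _ _ (proj i)) -(proj2 (P_measurement i)).
  apply: eq_bigr => b _; rewrite rmorphXn -exprMn mulrC /=.
  by rewrite (conj_prim_root d_gt0 w_prim) expr1n scale1r.
split; last exact: (stabilized_state_structure d_gt0 A_unitary A_incompatible).
move=> i; split=> //; rewrite -obsX -(proj2 (P_measurement i)).
(* At [k = d] all coefficients [omega ^+ (b * d)] are 1, leaving the completeness relation. *)
by apply: eq_bigr => b _; rewrite mulnC exprM (prim_expr_order w_prim) expr1n scale1r.
Qed.
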